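(* Let $f$ be a well-behaved mapping of a metric space $X$ into a normed space $Y$ such that $Z_f=\{z\in X:f(z)=0\}$ is inhabited and located in $X$. Then $f$ is Z-stable.
   Context: The setting is Bishop-style constructive mathematics (BISH): intuitionistic logic together with dependent choice; neither the law of excluded middle, nor LPO, nor Markov's principle may be used. $\rho$ denotes the metric on $X$. For elements $x,y$ of a metric space, $x\neq y$ means $\rho(x,y)>0$; in particular, $f(x)\neq0$ means $\|f(x)\|>0$. For $x\in X$, $S\subset X$ and $\varepsilon>0$, the expression $\rho(x,S)<\varepsilon$ means that there exists $y\in S$ with $\rho(x,y)<\varepsilon$. A subset $S$ of $X$ is located if the distance $\rho(x,S)=\inf\{\rho(x,y):y\in S\}$ exists for each $x\in X$. The complement of $Z_f$ in $X$ is $\mathord{\sim}Z_f=\{y\in X:\forall_{z\in Z_f}\,(y\neq z)\}$. The mapping $f$ is well behaved if $f(x)\neq0$ for each $x\in\mathord{\sim}Z_f$. The mapping $f$ is Z-stable if for each $x\in X$ and each $\varepsilon>0$ there exists $\delta>0$ such that if $\|f(x)\|<\delta$, then $\rho(x,Z_f)<\varepsilon$. *)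

(* Defs.v *)
(* Existence, disjunction and strict inequality are read as in Bishop-style
   mathematics, via propositions as types: "there exists" is [{ x : A & B }] or
   [{ x : A & B & C }], "and" between informative statements is [prod], and
   [x < y] on reals is the Set-valued [CRlt].  The negative relations [<=] and [==] on reals are in
   Prop.  [R] is any Cauchy-complete Archimedean ordered field in the sense of
   [ConstructiveReals]; its order is not assumed decidable. *)
From Stdlib Require Export ConstructiveReals.
From Stdlib Require Import Setoid Morphisms ConstructiveAbs.

Set Implicit Arguments.
Unset Strict Implicit.

Local Open Scope ConstructiveReals.

(* Sets carry their own equality, which maps have to respect.  For metric
   spaces [dist_eq0] makes [ms_eq] an equivalence compatible with [dist]. *)
Record MetricSpace (R : ConstructiveReals) : Type := {
  ms_car :> Type;
  ms_eq : ms_car -> ms_car -> Prop;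
  dist : ms_car -> ms_car -> CRcarrier R;
  dist_ge0 : forall x y, 0 <= dist x y;
  dist_eq0 : forall x y, dist x y == 0 <-> ms_eq x y;
  dist_sym : forall x y, dist x y == dist y x;
  dist_triangle : forall x y z, dist x z <= dist x y + dist y z
}.

Record NormedSpace (R : ConstructiveReals) : Type := {
  ns_car :> Type;
  ns_eq : ns_car -> ns_car -> Prop;
  ns_zero : ns_car;
  ns_add : ns_car -> ns_car -> ns_car;
  ns_opp : ns_car -> ns_car;
  ns_scal : CRcarrier R -> ns_car -> ns_car;
  norm : ns_car -> CRcarrier R;

  ns_eq_equiv : Equivalence ns_eq;
  ns_add_proper : Proper (ns_eq ==> ns_eq ==> ns_eq) ns_add;
  ns_opp_proper : Proper (ns_eq ==> ns_eq) ns_opp;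
  ns_scal_proper : Proper (CReq R ==> ns_eq ==> ns_eq) ns_scal;
  norm_proper : Proper (ns_eq ==> CReq R) norm;

  ns_addA : forall u v w,
    ns_eq (ns_add u (ns_add v w)) (ns_add (ns_add u v) w);
  ns_addC : forall u v, ns_eq (ns_add u v) (ns_add v u);
  ns_add0 : forall u, ns_eq (ns_add u ns_zero) u;
  ns_addN : forall u, ns_eq (ns_add u (ns_opp u)) ns_zero;
  ns_scalA : forall a b u,
    ns_eq (ns_scal a (ns_scal b u)) (ns_scal (a * b) u);
  ns_scal1 : forall u, ns_eq (ns_scal 1 u) u;
  ns_scalDr : forall a u v,
    ns_eq (ns_scal a (ns_add u v)) (ns_add (ns_scal a u) (ns_scal a v));
  ns_scalDl : forall a b u,
    ns_eq (ns_scal (a + b) u) (ns_add (ns_scal a u) (ns_scal b u));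

  norm_ge0 : forall u, 0 <= norm u;
  norm_eq0 : forall u, norm u == 0 <-> ns_eq u ns_zero;
  norm_scal : forall a u, norm (ns_scal a u) == CRabs R a * norm u;
  norm_triangle : forall u v, norm (ns_add u v) <= norm u + norm v
}.

Record Mapping (R : ConstructiveReals) (X : MetricSpace R) (Y : NormedSpace R)
  : Type := {
  map_fun :> X -> Y;
  map_ext : forall x x' : X, ms_eq x x' -> ns_eq (map_fun x) (map_fun x')
}.

(* A subset is given by a property whose proofs may carry information. *)
Definition Subset (R : ConstructiveReals) (X : MetricSpace R) := X -> Type.

Definition Inhabited (R : ConstructiveReals) (X : MetricSpace R)
  (S : Subset X) : Type := { y : X & S y }.

Definition ms_neq (R : ConstructiveReals) (X : MetricSpace R) (x y : X) : Set :=
  0 < dist x y.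

Definition Complement (R : ConstructiveReals) (X : MetricSpace R)
  (S : Subset X) : Subset X :=
  fun y => forall z, S z -> ms_neq y z.

(* The constructive infimum: values of [A] come arbitrarily close to [m].
   Being merely a greatest lower bound, as in Stdlib's [is_lub], is
   constructively weaker. *)
Definition IsInf (R : ConstructiveReals) (A : CRcarrier R -> Type)
  (m : CRcarrier R) : Type :=
  prod (forall r, A r -> m <= r)
       (forall eps, 0 < eps -> { r : CRcarrier R & A r & r < m + eps }).

Definition IsDistTo (R : ConstructiveReals) (X : MetricSpace R)
  (x : X) (S : Subset X) (d : CRcarrier R) : Type :=
  IsInf (fun r => { y : X & S y & r == dist x y }) d.

Definition Located (R : ConstructiveReals) (X : MetricSpace R)
  (S : Subset X) : Type :=
  forall x : X, { d : CRcarrier R & IsDistTo x S d }.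

(* [rho(x,S) < eps]; meaningful for every [S], located or not. *)
Definition DistToLt (R : ConstructiveReals) (X : MetricSpace R)
  (x : X) (S : Subset X) (eps : CRcarrier R) : Type :=
  { y : X & S y & dist x y < eps }.

Definition ZeroSet (R : ConstructiveReals) (X : MetricSpace R)
  (Y : NormedSpace R) (f : Mapping X Y) : Subset X :=
  fun z => ns_eq (f z) (ns_zero Y).

Definition WellBehaved (R : ConstructiveReals) (X : MetricSpace R)
  (Y : NormedSpace R) (f : Mapping X Y) : Type :=
  forall x : X, Complement (ZeroSet f) x -> 0 < norm (f x).

Definition ZStable (R : ConstructiveReals) (X : MetricSpace R)
  (Y : NormedSpace R) (f : Mapping X Y) : Type :=
  forall (x : X) (eps : CRcarrier R), 0 < eps ->
    { delta : CRcarrier R & 0 < delta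
      & norm (f x) < delta -> DistToLt x (ZeroSet f) eps }.

(* Main.v *)
Require Import Defs.

(* Cotransitivity applied to [0 < eps] gives [0 < rho(x, Z)] or
   [rho(x, Z) < eps].  In the first case [x] lies in the complement of [Z], so
   [delta = norm (f x)] is positive and [norm (f x) < delta] is absurd; in the
   second the conclusion already holds, and any [delta] will do. *)

Theorem proposition2p1 (R : ConstructiveReals) (X : MetricSpace R)
  (Y : NormedSpace R) (f : Mapping X Y)
  (hwb : WellBehaved f)
  (hinh : Inhabited (ZeroSet f))
  (hloc : Located (ZeroSet f)) :
  ZStable f.
Proof.
  intros x eps heps.
  destruct (hloc x) as [d [hlower happrox]].
  destruct (CRltLinear R) as [_ cotrans].
  destruct (cotrans 0%ConstructiveReals d eps heps) as [hd | hd].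
  - exists (norm (f x)).
    + apply hwb; intros z hz.
      (* Since [d] bounds the distances to zeros from below, [0 < d <= dist x z] keeps [x] apart
         from every zero [z]. *)
      apply (CRlt_le_trans _ d _ hd), hlower.
      exists z; [exact hz | reflexivity].
    + intros h; destruct (CRlt_asym _ _ h h).
  - exists 1%ConstructiveReals; [apply CRzero_lt_one | intros _].
    (* The tolerance [eps - d], positive by [hd], turns the bound [d + (eps - d)] on the
       approximating distance [r] into [eps], so the zero [z] realizing [r] lies within [eps] of
       [x]. *)
    destruct (happrox (eps - d)%ConstructiveReals) as [r [z hz hr] hlt].
    + apply (CRplus_lt_reg_r d).
      unfold CRminus.
      rewrite CRplus_0_l, CRplus_assoc, CRplus_opp_l, CRplus_0_r.
      exact hd.
    + exists z; [exact hz |].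
      rewrite <- hr.
      apply (CRlt_le_trans _ _ _ hlt).
      unfold CRminus.
      rewrite (CRplus_comm eps), <- CRplus_assoc, CRplus_opp_r, CRplus_0_l.
      apply CRle_refl.
Qed.
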